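(* Let $\mathcal I\subset\mathbb R$ be an open interval, $t_0\in\mathcal I$, and let $\mathcal M\subset\mathbb R^m$ be an open connected set. Let $A,\Phi:\mathcal I\times\mathcal M\to\mathbb R^{n\times n}$ be summable in $t$ over $\mathcal I$ for every $\mu\in\mathcal M$, and let $X^0:\mathcal M\to\mathbb R^{n\times n}$ be continuous and bounded. Suppose that 1) the functions $\widehat{\mathfrak n},\varphi,\eta:\mathcal M\to[0,+\infty)$ given by $$\widehat{\mathfrak n}(\mu)=\int_{\mathcal I}\|A(t,\mu)\|\,dt,\qquad \varphi(\mu)=\int_{\mathcal I}\|\Phi(t,\mu)\|\,dt,\qquad \eta(\mu)=\|X^0(\mu)\|$$ are bounded on $\mathcal M$; 2) $X^0$ is uniformly continuous on $\mathcal M$, and $A$ and $\Phi$ are integrally uniformly continuous on $\mathcal M$. Let $Y(t,\mu)$ be the solution of $$\frac{dX}{dt}=A(t,\mu)X+\Phi(t,\mu)\quad(t\in\mathcal I,\ \mu\in\mathcal M),\qquad X(t_0,\mu)=X^0(\mu),$$ and let $Z(t,\mu)$ be the solution of $$\frac{dX}{dt}=A(t,\mu)X\quad(t\in\mathcal I,\ \mu\in\mathcal M),\qquad X(t_0,\mu)=X^0(\mu).$$ Then $Y(t,\mu)$ is uniformly continuous in $\mu\in\mathcal M$, uniformly with respect to $t\in\mathcal I$; and the maps $\mathfrak F_0(\mu)(A,X^0)=Z(\cdot,\mu)$ and $\mathfrak F(\mu)(A,\Phi,X^0)=Y(\cdot,\mu)$ are uniformly continuous in $\mu$ on $\mathcal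 M$ (uniformly with respect to $t\in\mathcal I$). That is, for every $\varepsilon>0$ there is $\delta>0$ such that for all $\mu_1,\mu_2\in\mathcal M$ with $\|\mu_1-\mu_2\|<\delta$ one has $$\|Y(t,\mu_1)-Y(t,\mu_2)\|<\varepsilon,\quad \|Z(t,\mu_1)-Z(t,\mu_2)\|<\varepsilon\quad\text{for all }t\in\mathcal I,$$ $$\rho\bigl(Y(\cdot,\mu_1),Y(\cdot,\mu_2)\bigr)<\varepsilon,\qquad \rho\bigl(Z(\cdot,\mu_1),Z(\cdot,\mu_2)\bigr)<\varepsilon .$$
   Context: $\|\cdot\|$ denotes a norm on $\mathbb R^k$ and also a norm on matrices. Solutions are functions $\mathcal I\times\mathcal M\to\mathbb R^{n\times n}$ that are absolutely continuous in $t$ over $\mathcal I$ for every $\mu\in\mathcal M$ and satisfy the equation for almost every $t\in\mathcal I$. ''Summable over $\mathcal I$'' means Lebesgue integrable over $\mathcal I$. A function $B:\mathcal I\times\mathcal M\to\mathbb R^{n\times n}$, summable in $t$ over $\mathcal I$ for every $\mu\in\mathcal M$, is called integrally uniformly continuous on $\mathcal M$ if for every $\varepsilon>0$ there is $\delta>0$ such that $\int_{\mathcal I}\|B(t,\mu_1)-B(t,\mu_2)\|\,dt<\varepsilon$ for all $\mu_1,\mu_2\in\mathcal M$ with $\|\mu_1-\mu_2\|<\delta$. For matrix functions absolutely continuous in $t$ on $\mathcal I$, the metric $\rho$ is $$\rho\bigl(X(\cdot,\mu_1),X(\cdot,\mu_2)\bigr)=\|X(t_0,\mu_1)-X(t_0,\mu_2)\|+\int_{\mathcal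 I}\|\dot X(t,\mu_1)-\dot X(t,\mu_2)\|\,dt,$$ where $\dot X=dX/dt$. *)

(* Defs.v *)
From HB Require Import structures.
From mathcomp Require Import all_boot all_order all_algebra.
From mathcomp Require Import all_classical all_reals all_analysis.

Set Implicit Arguments.
Unset Strict Implicit.
Unset Printing Implicit Defensive.

Import Order.TTheory GRing.Theory Num.Theory.
Import numFieldNormedType.Exports.

Local Open Scope classical_set_scope.
Local Open Scope ring_scope.

Definition is_norm (R : realType) (V : lmodType R) (N : V -> R) : Prop :=
  [/\ forall u v, N (u + v) <= N u + N v,
      forall (a : R) v, N (a *: v) = `|a| * N v
    & forall v, N v = 0 -> v = 0].

(* [lebesgue_measure] lives on the Borel sets only; its completion is the
   measure of Lebesgue-measurable sets and functions. *)
Notation leb R := (@completed_lebesgue_measure R).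

(* All functions of (t, mu) below are total; only their values for t in I and
   mu in M matter. *)

Definition summable_on (R : realType) (m n : nat) (I : set R)
    (M : set 'rV[R]_m) (B : R -> 'rV[R]_m -> 'M[R]_n) : Prop :=
  forall mu, M mu -> forall i j,
    (leb R).-integrable I (fun t => (B t mu i j)%:E).

(* The integral is taken in \bar R, so that a bound on it also asserts that it
   is finite. *)
Definition norm_integral (R : realType) (m n : nat) (nrmM : 'M[R]_n -> R)
    (I : set R) (B : R -> 'rV[R]_m -> 'M[R]_n) (mu : 'rV[R]_m) : \bar R :=
  (\int[leb R]_(t in I) (nrmM (B t mu))%:E)%E.

Definition unif_continuous_on (R : realType) (m n : nat)
    (nrmV : 'rV[R]_m -> R) (nrmM : 'M[R]_n -> R) (M : set 'rV[R]_m)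
    (X0 : 'rV[R]_m -> 'M[R]_n) : Prop :=
  forall eps : R, 0 < eps -> exists2 delta : R, 0 < delta &
    forall mu1 mu2, M mu1 -> M mu2 -> nrmV (mu1 - mu2) < delta ->
      nrmM (X0 mu1 - X0 mu2) < eps.

Definition integrally_unif_continuous_on (R : realType) (m n : nat)
    (nrmV : 'rV[R]_m -> R) (nrmM : 'M[R]_n -> R) (I : set R)
    (M : set 'rV[R]_m) (B : R -> 'rV[R]_m -> 'M[R]_n) : Prop :=
  forall eps : R, 0 < eps -> exists2 delta : R, 0 < delta &
    forall mu1 mu2, M mu1 -> M mu2 -> nrmV (mu1 - mu2) < delta ->
      (\int[leb R]_(t in I) (nrmM (B t mu1 - B t mu2))%:E < eps%:E)%E.

Definition abs_continuous_on (R : realType) (n : nat) (nrmM : 'M[R]_n -> R)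
    (I : set R) (X : R -> 'M[R]_n) : Prop :=
  forall eps : R, 0 < eps -> exists2 delta : R, 0 < delta &
    forall (N : nat) (a b : 'I_N -> R),
      (forall k, [/\ I (a k), I (b k) & a k <= b k]) ->
      trivIset setT (fun k => `]a k, b k[%classic) ->
      \sum_(k < N) (b k - a k) < delta ->
      \sum_(k < N) nrmM (X (b k) - X (a k)) < eps.

Definition is_solution (R : realType) (m n : nat) (nrmM : 'M[R]_n -> R)
    (I : set R) (M : set 'rV[R]_m) (t0 : R)
    (F : R -> 'rV[R]_m -> 'M[R]_n -> 'M[R]_n)
    (X0 : 'rV[R]_m -> 'M[R]_n) (X : R -> 'rV[R]_m -> 'M[R]_n) : Prop :=
  forall mu, M mu ->
    [/\ abs_continuous_on nrmM I (X^~ mu),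
        {ae leb R, forall t : R, I t ->
          is_derive t 1 (X^~ mu) (F t mu (X t mu))}
      & X t0 mu = X0 mu].

(* [derive1 X] is unspecified where X is not derivable, a null set when X is
   absolutely continuous. *)
Definition rho (R : realType) (n : nat) (nrmM : 'M[R]_n -> R)
    (I : set R) (t0 : R) (X1 X2 : R -> 'M[R]_n) : \bar R :=
  ((nrmM (X1 t0 - X2 t0))%:E
   + \int[leb R]_(t in I) (nrmM (derive1 X1 t - derive1 X2 t))%:E)%E.

(* Main.v *)
Require Import Defs.
From HB Require Import structures.
From mathcomp Require Import all_boot all_order all_algebra.
From mathcomp Require Import all_classical all_reals all_analysis.
From mathcomp Require Import measurable_realfun lra ring.

Import Order.TTheory GRing.Theory Num.Theory.
Import numFieldNormedType.Exports.

Local Open Scope classical_set_scope.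
Local Open Scope ring_scope.

Set Implicit Arguments.
Unset Strict Implicit.
Unset Printing Implicit Defensive.

(** On a null set [N] covered by an open set of small measure, an absolutely
continuous function varies little; off [N] its increments are controlled by the
derivative.  A Cousin-type covering of a segment by intervals of these two kinds
turns an almost-everywhere differential inequality into a pointwise one.  Applied
to [|f| exp(-+ \int a) - \int psi], this gives Gronwall's inequality for
[|f'| <= a |f| + psi] a.e. with integrable [a] and [psi], on both sides of [t0].
The theorem follows by applying it to the difference [D] of two solutions, which
satisfies [D' = A1 D + (A1 - A2) X2 + (Phi1 - Phi2)], after bounding [X2] by the
same inequality.  All estimates are made in the entrywise l1 norm, which is
submultiplicative and makes measurability trivial; the given norm is equivalent
to it by compactness. *)

(** * Lebesgue measure on Borel sets and its completion *)

Lemma borel_completed_measurable (R : realType) (A : set (measurableTypeR R)) :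
  measurable A ->
  @measurable _ (caratheodory_type (wlength (@idfun R))^*%mu) A.
Proof. exact: sub_caratheodory. Qed.

Lemma completed_measurable_decomp (R : realType)
    (A : set (caratheodory_type (wlength (@idfun R))^*%mu)) :
  measurable A -> exists B : set (measurableTypeR R), measurable B /\
    exists2 N, (@lebesgue_measure R).-negligible N & A = B `|` N.
Proof.
move=> mA.
have : (completed_algebra_gen (@lebesgue_measure R)).-sigma.-measurable A.
  by rewrite completed_caratheodory_measurable.
by rewrite g_sigma_completed_algebra_genE => -[B mB [N nN <-]]; exists B; split => //; exists N.
Qed.

(** Both measures restrict the same outer measure. A null set of the completion is a Borel set
    together with a negligible one, and the Borel piece is null by monotonicity of that outer
    measure. *)
Lemma lebesgue_negligible_completed (R : realType) (E : set R) :
  (leb R).-negligible E <-> (@lebesgue_measure R).-negligible E.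
Proof.
split; last first.
  by move=> [N [mN N0 EN]]; exists N; split => //; exact: borel_completed_measurable.
move=> [N [mN N0 EN]].
have [B [mB [M [K [mK K0 MK]] NE]]] := completed_measurable_decomp mN.
apply: (negligibleS (A := B `|` K)).
  apply: (subset_trans EN); rewrite NE; exact: setUS.
apply: negligibleU; last by exists K; split.
exists B; split => //.
apply/eqP; rewrite eq_le measure_ge0 andbT.
rewrite -N0.
apply: (le_outer_measure (wlength (@idfun R))^*%mu).
by rewrite NE; exact: subsetUl.
Qed.

Lemma ae_completed_lebesgue (R : realType) (P : R -> Prop) :
  {ae leb R, forall t : R, P t} <-> {ae @lebesgue_measure R, forall t : R, P t}.
Proof. exact: lebesgue_negligible_completed. Qed.

(* N collects the null sets by which the superlevel sets of f at rational levels differ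
from Borel sets. *)
Lemma borel_representative (R : realType) (f : R -> R) :
  measurable_fun setT (f : caratheodory_type (wlength (@idfun R))^*%mu -> R) ->
  exists N : set (measurableTypeR R), [/\ measurable N, lebesgue_measure N = 0%E &
    measurable_fun setT (f \_ (~` N) : measurableTypeR R -> R)].
Proof.
move=> mf.
(* [q] enumerates the rationals by decoding indices; an index that decodes to nothing yields 0, and
   every rational still occurs. *)
pose q n : R := ratr (odflt 0 (unpickle n) : rat).
have H n : exists B N : set (measurableTypeR R),
    [/\ measurable B, measurable N, lebesgue_measure N = 0%E &
    [set x | q n < f x] `\` N = B `\` N].
  have mq : measurable ([set x | q n < f x] :
      set (caratheodory_type (wlength (@idfun R))^*%mu)).
    rewrite -[X in measurable X]setTI.
    have -> : [set x | q n < f x] = f @^-1` `]q n, +oo[.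
      by apply/seteqP; split => x /=; rewrite in_itv/= andbT.
    by apply: mf => //; exact: measurable_itv.
  have [B [mB [M [N [mN N0 MN]] ->]]] := completed_measurable_decomp mq.
  exists B, N; split => //.
  by rewrite setDUl (_ : M `\` N = set0) ?setU0//; apply/seteqP; split => x //= [/MN].
have /choice [B /choice [N BN]] := H.
pose N' := \bigcup_n N n.
have mN' : measurable N' by apply: bigcupT_measurable => n; have [] := BN n.
exists N'; split => //.
  apply/negligibleP => //; apply: negligible_bigcup => n.
  by have [_ mN N0 _] := BN n; exists (N n); split.
apply: (measurability (@RGenOInfty.G R)) => //; first exact: RGenOInfty.measurableE.
move=> _ [_ [c ->] <-]; rewrite setTI.
(* Off [N'], [c < f x] means that some rational level lies strictly between, which leaves a
   countable union of Borel sets. On [N'] the modified function is 0, so [N'] belongs to the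
   superlevel set exactly when [c < 0]. *)
have -> : (f \_ (~` N')) @^-1` `]c, +oo[ =
    (\bigcup_(n in [set n | c < q n]) (B n `\` N')) `|` (N' `&` [set x | c < 0]).
  apply/seteqP; split => x /=; rewrite in_itv/= andbT patchE.
    case: ifPn; rewrite ?inE ?notin_setE /= => Nx cf.
      left; have [r] := rat_in_itvoo cf; rewrite in_itv/= => /andP[cr rf].
      have qr : q (pickle r) = ratr r by rewrite /q pickleK.
      exists (pickle r); rewrite /= ?qr//; split => //.
      have [_ _ _] := BN (pickle r).
      move/seteqP => [+ _] => /(_ x); rewrite /= qr.
      case => //; split => // Nrx; apply: Nx; exists (pickle r) => //.
    by right; split => //; apply: contrapT.
  case => [[n cq [Bx Nx]]|[Nx c0]].
    rewrite mem_set //=; apply: (lt_trans cq).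
    have [_ _ _] := BN n.
    move/seteqP => [_ +] => /(_ x); case => //; split => // Nnx.
    by apply: Nx; exists n.
  by rewrite memNset.
apply: measurableU.
  apply: bigcup_measurable => n _; apply: measurableD => //.
  by have [] := BN n.
by apply: measurableI => //; have [c0|c0] := pselect (c < 0); 
  [rewrite (_ : mkset _ = setT)//; apply/seteqP; split|
   rewrite (_ : mkset _ = set0)//; apply/seteqP; split].
Qed.

(** Change of variables along the identity, which is measurable from the completed to the Borel
    sigma-algebra and pushes the completed measure forward to Lebesgue measure. *)
Lemma integral_completed_lebesgue (R : realType) (f : R -> R) :
  measurable_fun setT (f : measurableTypeR R -> R) -> (forall t, 0 <= f t) ->
  (\int[@lebesgue_measure R]_t (f t)%:E = \int[leb R]_t (f t)%:E)%E.
Proof.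
move=> mf f0.
have mf' : measurable_fun setT (EFin \o f : measurableTypeR R -> \bar R).
  exact/measurable_EFinP.
have := @ge0_integral_pushforward _ _ (caratheodory_type (wlength (@idfun R))^*%mu)
  (measurableTypeR R) R id _ (leb R) setT (EFin \o f) measurableT mf' (fun y _ => f0 y).
move=> E; match type of E with ?P -> _ => have mid : P end.
  by move=> _ B mB; rewrite setTI; exact: borel_completed_measurable.
rewrite -[RHS](E mid); apply: eq_measure_integral => A mA _.
by rewrite /pushforward.
Qed.

(** * Primitives of integrable functions and comparison of integrals *)

(** Supplies the primitives of [a] and [psi] in the Gronwall argument. After extension by 0 outside
    [I], a Borel function agreeing almost everywhere is integrated from minus infinity, so the bound
    [K] on the total mass bounds [G] everywhere, and Lebesgue differentiation gives its
    derivative. *)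
Lemma primitive_of_integrable (R : realType) (I : set R) (a : R -> R) (K : R) :
  measurable I -> (forall t, 0 <= a t) -> (leb R).-integrable I (EFin \o a) ->
  (\int[leb R]_(t in I) (a t)%:E <= K%:E)%E ->
  exists G : R -> R, [/\ {homo G : u v / u <= v}, forall u, 0 <= G u <= K &
    {ae leb R, forall t : R, I t -> is_derive t 1 G (a t)}].
Proof.
move=> mI a0 inta aK.
have mI' : @measurable _ (caratheodory_type (wlength (@idfun R))^*%mu) I.
  exact: borel_completed_measurable.
pose f := a \_ I.
have f0 t : 0 <= f t by rewrite /f patchE; case: ifP.
have mf : measurable_fun setT (f : caratheodory_type (wlength (@idfun R))^*%mu -> R).
  apply/(measurable_restrictT _ _).1 => //.
  by case/integrableP : inta => /measurable_EFinP.
have [N [mN N0 mg]] := borel_representative mf.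
(* Zeroing on the null set [N] can only decrease the nonnegative [f], so the bound [K] survives. *)
set g := f \_ (~` N) in mg.
have g0 t : 0 <= g t by rewrite /g patchE; case: ifP.
have intgK : (\int[@lebesgue_measure R]_t (g t)%:E <= K%:E)%E.
  rewrite integral_completed_lebesgue//; apply: le_trans aK.
  rewrite [leRHS]integral_mkcond.
  apply: ge0_le_integral => //.
  - by move=> t _; rewrite lee_fin.
  - apply/measurable_EFinP => _ B mB.
    by apply: borel_completed_measurable; exact: mg.
  - rewrite restrict_EFin; exact/measurable_EFinP.
  - by move=> t _; rewrite restrict_EFin lee_fin -/f /g patchE; case: ifP.
have intg : (@lebesgue_measure R).-integrable setT (EFin \o g).
  apply/integrableP; split; first exact/measurable_EFinP.
  under eq_integral do rewrite /= ger0_norm//.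
  by apply: le_lt_trans intgK _; rewrite ltry.
have intgy y : (@lebesgue_measure R).-integrable `]-oo, y] (EFin \o g).
  exact: integrableS intg.
exists (fun y => \int[@lebesgue_measure R]_(t in `]-oo, y]) g t); split.
- move=> u v uv; apply: fine_le; [exact: integrable_fin_num|exact: integrable_fin_num|].
  apply: ge0_subset_integral => //=.
  + apply/measurable_EFinP; apply: measurable_funS mg => //.
  + by move=> t _; rewrite lee_fin.
  + by move=> t /=; rewrite !in_itv/= => /le_trans; apply.
- move=> u; apply/andP; split.
    by apply: fine_ge0; apply: integral_ge0 => t _; rewrite lee_fin.
  rewrite -lee_fin fineK; last exact: integrable_fin_num.
  apply: le_trans intgK; apply: ge0_subset_integral => //=.
  + exact/measurable_EFinP.
  + by move=> t _; rewrite lee_fin.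
- apply/ae_completed_lebesgue.
  have loc : locally_integrable [set: R] g.
    by apply: open_integrable_locally => //; exact: openT.
  have aeN : {ae @lebesgue_measure R, forall t, ~ N t}.
    by exists N; split => // t /= /contrapT.
  move: (FTC1Ny intgy loc) aeN; apply: filterS2.
    exact: (ae_filter_ringOfSetsType (@lebesgue_measure R)).
  move=> t [dG GE] Nt It.
  apply: DeriveDef => //; rewrite -derive1E GE /g patchE mem_set// /f patchE mem_set//.
Qed.

(* [nrmM (derive1 X1 t - derive1 X2 t)] is not known to be measurable, so it has to
be compared with other integrands without measurability on its side. *)
Section nonmeasurable_integrand.
Import HBNNSimple.

Lemma ge0_le_integral_nonmeasurable d (T : measurableType d) (R : realType)
    (mu : {measure set T -> \bar R}) (D : set T) (f1 f2 : T -> \bar R) :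
  (forall x, D x -> (0 <= f1 x)%E) -> (forall x, D x -> (f1 x <= f2 x)%E) ->
  (\int[mu]_(x in D) f1 x <= \int[mu]_(x in D) f2 x)%E.
Proof.
move=> f10 f12.
rewrite [leLHS]integral_mkcond [leRHS]integral_mkcond.
rewrite !ge0_integralTE; last 2 first.
- by apply: erestrict_ge0 => x Dx; apply: le_trans (f12 _ Dx); exact: f10.
- exact: erestrict_ge0.
apply: ereal_sup_le => _ [h /= hf1 <-].
exists h => //= x; apply: le_trans (hf1 x) _.
exact: lee_restrict.
Qed.

Lemma ge0_le_integral_dominating d (T : measurableType d) (R : realType)
    (mu : {measure set T -> \bar R}) (D : set T) (f1 f2 : T -> \bar R) :
  measurable D -> (forall x, D x -> (0 <= f1 x)%E) ->
  (forall x, D x -> (0 <= f2 x)%E) -> measurable_fun D f2 ->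
  {ae mu, forall x, D x -> (f1 x <= f2 x)%E} ->
  (\int[mu]_(x in D) f1 x <= \int[mu]_(x in D) f2 x)%E.
Proof.
move=> mD f10 f20 mf2 f12.
rewrite [leLHS]integral_mkcond ge0_integralTE; last first.
  by move=> x; exact: erestrict_ge0.
(* The left integral is a supremum over simple functions below [f1]. Each such [h] is measurable, so
   the almost-everywhere comparison applies to [h] and [f2]. *)
apply: ge_ereal_sup => _ [h /= hf1 <-].
rewrite -[leLHS](integralT_nnsfun mu h).
rewrite [leRHS]integral_mkcond.
apply: ae_ge0_le_integral => //.
- by move=> x _; rewrite lee_fin; exact: fun_ge0.
- exact/measurable_EFinP.
- by move=> x _; exact: erestrict_ge0.
- exact/(measurable_restrictT _ _).1.
- apply: filterS f12 => x f12 _.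
  apply: (le_trans (hf1 x)); rewrite !patchE; case: ifPn => //.
  by rewrite inE.
Qed.

End nonmeasurable_integrand.

(** * From an almost-everywhere derivative bound to monotonicity *)

Lemma null_set_open_cover (R : realType) (E : set R) (eps : R) :
  (leb R).-negligible E -> 0 < eps ->
  exists U : set R, [/\ open U, E `<=` U & (lebesgue_measure U < eps%:E)%E].
Proof.
move=> /lebesgue_negligible_completed [N [mN N0 EN]] eps0.
have [|U [oU NU UN]] := lebesgue_regularity_outer mN _ eps0.
  by rewrite [ltLHS](_ : _ = 0%E) ?ltry//; exact: N0.
exists U; split => //; first exact: subset_trans NU.
apply: le_lt_trans UN.
have -> : U = (U `\` N) `|` N by rewrite setUC setDUK.
apply: le_trans (measureU2 _ _ _) _ => //.
  by apply: measurableD => //; exact: open_measurable.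
rewrite [X in (_ + X)%E](_ : _ = 0%E); last exact: N0.
by rewrite adde0 setUC setDUK.
Qed.

Lemma sum_lengths_lt (R : realType) (U : set R) (eps : R) (s : seq (R * R)) :
  open U -> (lebesgue_measure U < eps%:E)%E ->
  (forall p, p \in s -> p.1 <= p.2 /\ `[p.1, p.2] `<=` U) ->
  trivIset setT (fun k : 'I_(size s) =>
    `](tnth (in_tuple s) k).1, (tnth (in_tuple s) k).2[%classic) ->
  \sum_(k < size s) ((tnth (in_tuple s) k).2 - (tnth (in_tuple s) k).1) < eps.
Proof.
move=> oU mU sU tr.
rewrite -lte_fin; apply: le_lt_trans mU.
rewrite -sumEFin.
rewrite [leLHS](eq_bigr (fun k => lebesgue_measure
   (`](tnth (in_tuple s) k).1, (tnth (in_tuple s) k).2[%classic : set R))); last first.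
  move=> k _; have [le _] := sU _ (mem_tnth k (in_tuple s)).
  rewrite lebesgue_measure_itv/= lte_fin; case: ltP => // ge.
  by rewrite (@le_anti _ _ (tnth (in_tuple s) k).1 (tnth (in_tuple s) k).2) ?subrr// le.
rewrite -(measure_bigsetU_ord _ (fun=> true))//.
apply: le_measure; rewrite ?inE.
- by apply: bigsetU_measurable => k _; exact: measurable_itv.
- exact: open_measurable.
- rewrite -bigcup_seq => t [k _ kt].
  have [_] := sU _ (mem_tnth k (in_tuple s)); apply.
  exact: subset_itvW kt.
Qed.

(** Continuous induction on the segment from [u] to [v]. The exceptional set lies in an open [U] of
    measure below [delta], so the increments of [f], which dominate those of [h], sum to less than
    [eps] over finitely many disjoint intervals inside [U]; at other points the local hypothesis
    costs at most [eps] per unit length. *)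
Lemma nonincreasing_of_ae_derivative (R : realType) (n : nat) (nrm : 'M[R]_n -> R)
    (I : set R) (f : R -> 'M[R]_n) (h : R -> R) :
  is_interval I -> abs_continuous_on nrm I f ->
  (forall u v, I u -> I v -> u <= v -> h v - h u <= nrm (f v - f u)) ->
  {ae leb R, forall t : R, I t -> forall eps : R, 0 < eps ->
     exists2 delta : R, 0 < delta & forall s, I s -> `|s - t| < delta ->
       (t <= s -> h s - h t <= eps * (s - t)) /\
       (s <= t -> h t - h s <= eps * (t - s))} ->
  forall u v, I u -> I v -> u <= v -> h v <= h u.
Proof.
move=> Iitv fAC hf [N [mN N0 bad]] u v Iu Iv uv.
(* Good points cost [eps * (v - u)] in total, the intervals around exceptional points one further
   [eps]. *)
suff H (eps : R) : 0 < eps -> h v - h u <= eps * (v - u + 1).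
  rewrite -subr_le0; apply/ler_addgt0Pr => e e0; rewrite add0r.
  have vu : 0 < v - u + 1 by rewrite ltr_wpDl// subr_ge0.
  by apply: (le_trans (H (e / (v - u + 1)) _)); rewrite ?divr_gt0// divfK// gt_eqF.
move=> eps0.
have [delta delta0 fdelta] := fAC _ eps0.
have negN : (leb R).-negligible (N : set R) by exists N; split.
have [U [oU NU mU]] := null_set_open_cover negN delta0.
have Ist s : u <= s -> s <= v -> I s.
  by move=> us sv; apply: (Iitv _ _ Iu Iv); rewrite us.
(* [s] lists, from right to left, the intervals used at exceptional points on the way from [u] to
   [t]; the rest is paid for by [eps * (t - u)]. *)
pose chain (t : R) (s : seq (R * R)) :=
  [/\ forall p, p \in s -> [/\ u <= p.1, p.1 <= p.2, p.2 <= t & `[p.1, p.2] `<=` U],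
      pairwise (fun p q => q.2 <= p.1) s &
      h t - h u <= eps * (t - u) + \sum_(p <- s) nrm (f p.2 - f p.1)].
pose T := [set t | u <= t <= v /\ exists s, chain t s].
have Tu : T u.
  split; first by rewrite lexx.
  by exists [::]; split => //; rewrite big_nil !subrr mulr0 addr0.
have Tub : has_sup T.
  by split; [exists u|exists v => t [/andP[]]].
pose c := sup T.
have uc : u <= c by apply: ub_le_sup => //; case: Tub.
have cv : c <= v by apply: ge_sup; [exists u|move=> t [/andP[]]].
have Ic := Ist _ uc cv.
(* Prolongs a chain from [x] across the supremum [c] to [y]: for [c] in [N] the pair [(x, y)] joins
   the list, otherwise the two one-sided estimates at [c] are added. *)
have step (x y : R) s (d : R) : chain x s -> u <= x -> x <= c -> c <= y -> y <= v ->
    (U c -> `[x, y] `<=` U) ->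
    (~ N c -> forall z, I z -> `|z - c| < d -> 
       (c <= z -> h z - h c <= eps * (z - c)) /\
       (z <= c -> h c - h z <= eps * (c - z))) ->
    `|x - c| < d -> `|y - c| < d -> exists s, chain y s.
  move=> [sP sW sh] ux xc cy yv Uc Nc xd yd.
  have xy := le_trans xc cy.
  have Ix := Ist _ ux (le_trans xy yv).
  have Iy := Ist _ (le_trans ux xy) yv.
  have [cN|cN] := pselect (N c).
    exists ((x, y) :: s); split.
    - move=> p; rewrite inE => /predU1P[->|/sP[up pp px pU]]; first by split => //; exact/Uc/NU.
      by split => //; exact: le_trans xy.
    - rewrite /= sW andbT; apply/allP => p /sP[]//.
    - rewrite big_cons/=.
      have := hf _ _ Ix Iy xy; have : 0 <= eps * (y - x).
        by rewrite mulr_ge0 ?subr_ge0// ltW.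
      by move: sh; rewrite !mulrBr; lra.
  exists s; split => //.
  - by move=> p /sP[up pp px pU]; split => //; exact: le_trans xy.
  - have [/(_ cy) hy _] := Nc cN _ Iy yd.
    have [_ /(_ xc) hx] := Nc cN _ Ix xd.
    by move: sh hx hy; rewrite !mulrBr; lra.
have [d1 d10 dU] : exists2 d : R, 0 < d & U c -> ball c d `<=` U.
  have [cU|cU] := pselect (U c); last by exists 1.
  by have /nbhs_ballP[d d0 dU] : nbhs c U; [exact: open_nbhs_nbhs|exists d].
have [d2 d20 dN] : exists2 d : R, 0 < d & ~ N c -> forall z, I z -> `|z - c| < d ->
    (c <= z -> h z - h c <= eps * (z - c)) /\
    (z <= c -> h c - h z <= eps * (c - z)).
  have [cN|cN] := pselect (N c); first by exists 1.
  have /(_ Ic _ eps0)[d d0 dh] := contrapT (fun bad_c => cN (bad c bad_c)).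
  by exists d.
pose d := Num.min d1 d2.
have d0 : 0 < d by rewrite lt_min d10.
have dd1 : d <= d1 by rewrite ge_min lexx.
have dd2 : d <= d2 by rewrite ge_min lexx orbT.
have [x [[/andP[ux xv] [s xs]] xcd]] : exists x : R, T x /\ c - d < x.
  by have [x Tx] := sup_adherent d0 Tub; exists x.
have xc : x <= c by apply: ub_le_sup; [case: Tub|split; [rewrite ux|exists s]].
pose y := Num.min (c + d / 2) v.
have cy : c <= y by rewrite /y le_min cv andbT lerDl divr_ge0// ltW.
have yv : y <= v by rewrite /y ge_min lexx orbT.
have yd : y <= c + d / 2 by rewrite /y ge_min lexx.
have [s' ys'] : exists s, chain y s.
  apply: (step x y s d) => //.
  - move=> Uc z /=; rewrite in_itv/= => /andP[xz zy]; apply: dU => //.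
    by rewrite /ball/= ltr_norml; apply/andP; split; move: xcd yd dd1 d0; lra.
  - by move=> cN z Iz zd; apply: dN => //; exact: lt_le_trans dd2.
  - by rewrite ler0_norm ?subr_le0//; lra.
  - by rewrite ger0_norm ?subr_ge0//; lra.
(* [y] is itself reached by a chain, hence [y <= c]; as [c + d / 2] exceeds [c], the minimum
   defining [y] must be [v]. *)
have yE : y = v.
  have yc : y <= c.
    by apply: ub_le_sup; [case: Tub|split; [rewrite (le_trans uc)|exists s']].
  move: (yc); rewrite {1}/y ge_min => /orP[cd|vc]; last first.
    by apply/le_anti; rewrite yv (le_trans vc cy).
  have : c < c + d / 2 by lra.
  by rewrite ltNge cd.
move: ys'; rewrite yE => -[sP sW sh].
apply: (le_trans sh); rewrite [leRHS]mulrDr mulr1 lerD2l; apply: ltW.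
rewrite big_tnth.
have trs : trivIset setT (fun k : 'I_(size s') =>
    `](tnth (in_tuple s') k).1, (tnth (in_tuple s') k).2[%classic).
  have trk (j k : 'I_(size s')) : (j < k)%N ->
      (tnth (in_tuple s') k).2 <= (tnth (in_tuple s') j).1.
    move=> jk; move: sW => /(pairwiseP (0, 0)) /(_ j k); rewrite !inE !ltn_ord.
    by move=> /(_ isT isT jk); rewrite !(tnth_nth (0, 0)).
  apply/trivIsetP => j k _ _ jk; apply/seteqP; split => // z [/=].
  rewrite !in_itv/= => /andP[j1 j2] /andP[k1 k2].
  by move: jk; rewrite neq_ltn => /orP[/trk|/trk]; lra.
apply: (fdelta _ (fun k => (tnth (in_tuple s') k).1) (fun k => (tnth (in_tuple s') k).2)) => //.
- move=> k; have [uk kk kv _] := sP _ (mem_tnth k (in_tuple s')); split => //.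
  + by apply: Ist => //; exact: le_trans kv.
  + by apply: Ist => //; exact: le_trans kk.
- by apply: (sum_lengths_lt oU mU) => // p /sP[].
Qed.

(** * The entrywise l1 norm and its equivalence with a given norm *)

Definition mxl1 (R : realType) (n : nat) (u : 'M[R]_n) : R :=
  \sum_(ij : 'I_n * 'I_n) `|u ij.1 ij.2|.

Lemma entry_le_mx_norm (R : realType) (m n : nat) (u : 'M[R]_(m, n)) i j :
  `|u i j| <= `|u|.
Proof.
rewrite [leRHS]/Num.Def.normr/= mx_normrE.
by apply: (@le_bigmax _ _ _ _ (fun ij => `|u ij.1 ij.2|) (i, j)).
Qed.

Lemma lipschitz_continuousW (R : realType) (V : normedModType R) (g : V -> R) (K : R) :
  0 < K -> (forall v w, `|g v - g w| <= K * `|v - w|) -> continuous g.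
Proof.
move=> K0 gK v; apply/cvgrPdist_le => e e0.
apply/nbhs_normP; exists (e / K); rewrite /= ?divr_gt0// => w /= vw.
apply: le_trans (gK v w) _; rewrite mulrC -ler_pdivlMr//; exact: ltW.
Qed.

Section mxl1_theory.
Variables (R : realType) (n : nat).
Implicit Types u v : 'M[R]_n.

Lemma mxl1_ge0 u : 0 <= mxl1 u.
Proof. by apply: sumr_ge0. Qed.

Lemma mxl1D u v : mxl1 (u + v) <= mxl1 u + mxl1 v.
Proof.
by rewrite -big_split/=; apply: ler_sum => ij _; rewrite mxE; exact: ler_normD.
Qed.

Lemma mxl1Z (a : R) u : mxl1 (a *: u) = `|a| * mxl1 u.
Proof. by rewrite mulr_sumr; apply: eq_bigr => ij _; rewrite mxE normrM. Qed.

Lemma mxl1_dist u v : `|mxl1 u - mxl1 v| <= mxl1 (u - v).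
Proof.
have tri (w z : 'M[R]_n) : mxl1 w - mxl1 z <= mxl1 (w - z).
  by rewrite lerBlDr; have := mxl1D (w - z) z; rewrite subrK.
rewrite ler_norml tri andbT lerNl opprB; apply: le_trans (tri _ _) _.
by rewrite -[v - u]opprB -scaleN1r mxl1Z normrN1 mul1r.
Qed.

(** After the triangle inequality, enlarging each row sum of [v] to the sum over all its entries
    decouples the two factors. *)
Lemma mxl1M u v : mxl1 (u *m v) <= mxl1 u * mxl1 v.
Proof.
rewrite /mxl1 mulr_suml -[leRHS](pair_bigA _ (fun i k =>
  `|u i k| * \sum_ij `|v ij.1 ij.2|))/=.
rewrite -[leLHS](pair_bigA _ (fun i j => `|(u *m v) i j|))/=.
apply: ler_sum => i _.
apply: (@le_trans _ _ (\sum_j \sum_k `|u i k| * `|v k j|)).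
  apply: ler_sum => j _; rewrite mxE; apply: le_trans (ler_norm_sum _ _ _) _.
  by apply: ler_sum => k _; rewrite normrM.
rewrite exchange_big/=; apply: ler_sum => k _; rewrite -mulr_sumr.
apply: ler_wpM2l => //; rewrite -(pair_bigA _ (fun k j => `|v k j|))/=.
rewrite [leRHS](bigD1 k)//= lerDl.
by apply: sumr_ge0 => l _; exact: sumr_ge0.
Qed.

Lemma mxl1_le_mx_norm u : mxl1 u <= (n * n)%:R * `|u|.
Proof.
have -> : (n * n)%:R * `|u| = \sum_(ij : 'I_n * 'I_n) `|u|.
  by rewrite sumr_const card_prod card_ord mulr_natl.
by apply: ler_sum => ij _; exact: entry_le_mx_norm.
Qed.

Lemma mxl1_vec_mx_le (v : 'rV[R]_(n * n)) :
  mxl1 (vec_mx v) <= (n * n)%:R * `|v|.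
Proof.
have -> : (n * n)%:R * `|v| = \sum_(ij : 'I_n * 'I_n) `|v|.
  by rewrite sumr_const card_prod card_ord mulr_natl.
by apply: ler_sum => ij _; rewrite mxE; exact: entry_le_mx_norm.
Qed.

Lemma mx_norm_le_mxl1 (v : 'rV[R]_(n * n)) : `|v| <= mxl1 (vec_mx v).
Proof.
rewrite [leLHS]/Num.Def.normr/= mx_normrE; apply/bigmax_leP; split; first exact: mxl1_ge0.
move=> [i k] _ /=; rewrite (ord1 i).
case/mxvec_indexP: k => a b; rewrite /mxl1 (bigD1 (a, b))//= mxE lerDl.
exact: sumr_ge0.
Qed.

Lemma norm_le_mxl1 (N : 'M[R]_n -> R) : is_norm N ->
  exists2 C, 0 <= C & forall u, N u <= C * mxl1 u.
Proof.
move=> [ND NZ _].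
have N0 : N 0 = 0 by rewrite -(scale0r 0) NZ normr0 mul0r.
have Nge0 u : 0 <= N u.
  have := ND u (- u); rewrite subrr N0 -scaleN1r NZ normrN1 mul1r.
  by rewrite -mulr2n pmulrn_lge0.
exists (\sum_ij N (delta_mx ij.1 ij.2)); first exact: sumr_ge0.
move=> u; rewrite {1}(matrix_sum_delta u).
rewrite (pair_bigA _ (fun i j => u i j *: delta_mx i j))/=.
apply: (@le_trans _ _ (\sum_ij `|u ij.1 ij.2| * N (delta_mx ij.1 ij.2))).
  elim/big_ind2 : _ => [|x x' y y' Hx Hy|ij _]; first by rewrite N0.
    by apply: le_trans (ND _ _) _; exact: lerD.
  by rewrite NZ.
rewrite mulr_suml; apply: ler_sum => ij _; rewrite mulrC.
apply: ler_wpM2l => //; rewrite /mxl1 [leRHS](bigD1 ij)//= lerDl.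
exact: sumr_ge0.
Qed.

(** The minimum of [N] over the l1 unit sphere is positive because [N] vanishes only at 0;
    homogeneity carries the bound to all matrices. *)
Lemma mxl1_le_norm (N : 'M[R]_n -> R) : is_norm N ->
  exists2 C, 0 < C & forall u, mxl1 u <= C * N u.
Proof.
move=> Nnorm; have [C C0 NC] := norm_le_mxl1 Nnorm.
case: Nnorm => ND NZ Neq0.
have N0 : N 0 = 0 by rewrite -(scale0r 0) NZ normr0 mul0r.
have NN u : N (- u) = N u by rewrite -scaleN1r NZ normrN1 mul1r.
have Nge0 u : 0 <= N u.
  have := ND u (- u); rewrite subrr N0 NN.
  by rewrite -mulr2n pmulrn_lge0.
have Ndist u v : `|N u - N v| <= N (u - v).
  have tri (w z : 'M[R]_n) : N w - N z <= N (w - z).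
    by rewrite lerBlDr; have := ND (w - z) z; rewrite subrK.
  by rewrite ler_norml tri andbT lerNl opprB; apply: le_trans (tri _ _) _; rewrite -opprB NN.
(* Matrices are flattened to row vectors, where closed bounded sets are compact and a continuous
   function attains its minimum. *)
pose S := [set v : 'rV[R]_(n * n) | mxl1 (vec_mx v) = 1].
pose F := fun v : 'rV[R]_(n * n) => N (vec_mx v).
pose L := fun v : 'rV[R]_(n * n) => mxl1 (vec_mx v : 'M[R]_n).
have lip (g : 'rV[R]_(n * n) -> R) (K : R) : 0 <= K ->
   (forall v w : 'rV[R]_(n * n), `|g v - g w| <= K * L (v - w)) -> continuous g.
  move=> K0 gL.
  have K1 : 0 < K * (n * n)%:R + 1 by rewrite ltr_wpDl// mulr_ge0.
  apply: (lipschitz_continuousW K1) => v w; apply: le_trans (gL _ _) _.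
  rewrite mulrDl mul1r -mulrA; apply: ler_wpDr => //.
  by apply: ler_wpM2l => //; exact: mxl1_vec_mx_le.
have cF : continuous F.
  apply: (lip _ C C0) => v w; apply: le_trans (Ndist _ _) _.
  by rewrite -linearB; exact: NC.
have cL : continuous L.
  apply: (lip _ 1) => // v w; rewrite mul1r; apply: le_trans (mxl1_dist _ _) _.
  by rewrite -linearB.
have cS : compact S.
  apply: bounded_closed_compact.
    exists 1; split => // M M1 v /= Sv; apply: ltW; apply: le_lt_trans M1.
    by rewrite -Sv; exact: mx_norm_le_mxl1.
  have -> : S = L @^-1` [set 1] by [].
  by apply: closed_comp => // v _; exact: cL.
(* The sphere is empty only if every matrix has l1 norm 0, as for [n = 0]; the constant 1 then
   works. *)
have [S0|S0] := pselect (S !=set0); last first.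
  exists 1 => // u; rewrite mul1r.
  suff -> : mxl1 u = 0 by [].
  apply: contrapT => /eqP u0; apply: S0; exists (mxvec ((mxl1 u)^-1 *: u)).
  by rewrite /S/= mxvecK mxl1Z ger0_norm ?invr_ge0 ?mxl1_ge0// mulVf.
have [c cinS cmin] := EVT_min_rV S0 cS (continuous_subspaceT cF).
have Fc : 0 < F c.
  rewrite lt_neqAle Nge0 andbT eq_sym; apply/eqP => /Neq0 c0.
  move: cinS; rewrite inE /S/= c0 /mxl1 big1 => [/esym/eqP|]; first by rewrite oner_eq0.
  by move=> ij _; rewrite mxE normr0.
exists (F c)^-1; first by rewrite invr_gt0.
move=> u; have [u0|u0] := eqVneq (mxl1 u) 0.
  by rewrite u0 mulr_ge0// invr_ge0 ltW.
rewrite ler_pdivlMl// -ler_pdivlMr; last by rewrite lt_neqAle eq_sym u0 mxl1_ge0.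
have -> : N u / mxl1 u = F (mxvec ((mxl1 u)^-1 *: u)).
  by rewrite /F mxvecK NZ ger0_norm ?invr_ge0 ?mxl1_ge0// mulrC.
apply: cmin; rewrite inE /S/= mxvecK mxl1Z ger0_norm ?invr_ge0 ?mxl1_ge0//.
by rewrite mulVf.
Qed.

End mxl1_theory.

(** * Gronwall's inequality under almost-everywhere hypotheses *)

Lemma is_derive_near (R : realType) (V : normedModType R) (f : R -> V) (t : R) (d : V)
    (eps : R) : is_derive t 1 f d -> 0 < eps ->
  exists2 delta : R, 0 < delta & forall s, `|s - t| < delta ->
    `|f s - f t - (s - t) *: d| <= eps * `|s - t|.
Proof.
move=> [df dE] eps0.
have : h^-1 *: ((f \o shift t) (h *: 1) - f t) @[h --> 0^'] --> d by rewrite -dE.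
move=> /cvgrPdist_le /(_ _ eps0) => /nbhs_normP[delta /= delta0 H].
exists delta => // s st.
have [->|snt] := eqVneq s t; first by rewrite !subrr scale0r subrr !normr0 mulr0.
have snt0 : s - t != 0 by rewrite subr_eq0.
have := H (s - t); rewrite /= sub0r normrN => /(_ st snt0).
rewrite /shift/= [(s - t) *: 1]mulr1 subrK => K.
rewrite [leRHS]mulrC -ler_pdivrMl ?normr_gt0// -normfV -normrZ.
by rewrite scalerBr scalerA mulVf// scale1r distrC.
Qed.

(* With [E = exp(- int a)] and [sg = 1] the monotone quantity propagates bounds to the
right of [t0]; with [E = exp(int a - alpha)] and [sg = -1], to the left.  As [E <= 1]
and [sg * E] and [- P] are nonincreasing, the increments of [h] are dominated by
those of [f], so no absolute continuity of [E] and [P] is needed. *)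
Section damped.
Variables (R : realType) (n : nat) (I : set R) (f : R -> 'M[R]_n).
Variables (sg : R) (a psi E P : R -> R).
Hypotheses (Iitv : is_interval I) (fAC : abs_continuous_on (@mxl1 R n) I f).
Hypotheses (sg1 : sg = 1 \/ sg = -1) (E01 : forall t, 0 <= E t <= 1).
Hypothesis (Emono : forall u v, u <= v -> sg * E v <= sg * E u).
Hypothesis (Pmono : {homo P : u v / u <= v}).
Hypothesis psi0 : forall t, 0 <= psi t.
Hypothesis df : {ae leb R, forall t : R, I t ->
  exists2 d, is_derive t 1 f d & mxl1 d <= a t * mxl1 (f t) + psi t}.
Hypothesis dE : {ae leb R, forall t : R, I t -> is_derive t 1 E (- sg * a t * E t)}.
Hypothesis dP : {ae leb R, forall t : R, I t -> is_derive t 1 P (psi t)}.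

Let h t := sg * mxl1 (f t) * E t - P t.

Let h_incr u v : u <= v -> h v - h u <= mxl1 (f v - f u).
Proof.
move=> uv; rewrite /h.
have := Pmono uv; have := Emono uv.
have := mxl1_dist (f v) (f u); rewrite ler_norml => /andP[].
have /andP[] := E01 u; have /andP[] := E01 v.
have := mxl1_ge0 (f u); have := mxl1_ge0 (f v).
move: (mxl1 (f v - f u)) (mxl1 (f u)) (mxl1 (f v)) (E u) (E v) (P u) (P v).
by move=> D x y eu ev pu pv; case: sg1 => ->; nra.
Qed.

Lemma damped_nonincreasing u v : I u -> I v -> u <= v -> h v <= h u.
Proof.
apply: (nonincreasing_of_ae_derivative Iitv fAC) => [x y _ _|]; first exact: h_incr.
have dEP : {ae leb R, forall t : R, I t ->
    is_derive t 1 E (- sg * a t * E t) /\ is_derive t 1 P (psi t)}.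
  move: dE dP; apply: filterS2; first exact: (ae_filter_ringOfSetsType (leb R)).
  by move=> t dEt dPt It; split; [exact: dEt|exact: dPt].
move: df dEP; apply: filterS2; first exact: (ae_filter_ringOfSetsType (leb R)).
move=> t dft dEPt It eps eps0.
have [d fd dle] := dft It; have [Ed Pd] := dEPt It.
(* [k] freezes [mxl1 (f t)]. It is differentiable at [t], although [s |-> mxl1 (f s)] need not be,
   and [h s - h t] splits into [k s - k t] plus the variation of [mxl1 (f s)] weighted by
   [sg * E s]. *)
pose k s := sg * mxl1 (f t) * E s - P s.
have kd : is_derive t 1 k (- (a t * mxl1 (f t) * E t) - psi t).
  have : is_derive t 1 k ((sg * mxl1 (f t)) *: (- sg * a t * E t) - psi t).
    by apply: is_deriveB; apply: is_deriveZ.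
  have sg2 : sg * sg = 1 by case: sg1 => ->; rewrite ?mulrNN mulr1.
  rewrite /GRing.scale/= (_ : sg * mxl1 (f t) * _ =
    - (sg * sg * (a t * mxl1 (f t) * E t))); last by ring.
  by rewrite sg2 mul1r.
pose D := mxl1 d.
have D0 : 0 <= D by exact: mxl1_ge0.
(* The errors collected in [key] are at most [e * (3 + D)], by [e <= 1] and [E t <= 1]. *)
pose e := Num.min 1 (eps / (3 + D)).
have e0 : 0 < e by rewrite lt_min ltr01 divr_gt0// ltr_wpDr.
have e1 : e <= 1 by rewrite ge_min lexx.
have eD : e * (3 + D) <= eps.
  by rewrite -ler_pdivlMr ?ltr_wpDr// ge_min lexx orbT.
have [d1 d10 kn] := is_derive_near kd e0.
(* Factor from the entrywise maximum norm to the l1 norm; the added 1 keeps it positive when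
   [n = 0]. *)
pose c : R := (n * n)%:R + 1.
have c0 : 0 < c by rewrite ltr_wpDl.
have [d2 d20 fn] := is_derive_near fd (divr_gt0 e0 c0).
have cE : {for t, continuous E} by apply/differentiable_continuous/derivable1_diffP; case: Ed.
have /cvgrPdist_le /(_ _ e0) /nbhs_normP[d3 /= d30 En] := cE.
exists (Num.min d1 (Num.min d2 d3)); first by rewrite !lt_min d10 d20.
move=> s Is; rewrite !lt_min => /and3P[s1 s2 s3].
have fl1 : `|mxl1 (f s) - mxl1 (f t)| <= `|s - t| * (D + e).
  apply: le_trans (mxl1_dist _ _) _.
  rewrite -(subrK ((s - t) *: d) (f s - f t)).
  apply: le_trans (mxl1D _ _) _; rewrite mxl1Z addrC mulrDr lerD2l.
  apply: le_trans (mxl1_le_mx_norm _) _.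
  apply: (@le_trans _ _ (c * (e / c * `|s - t|))).
    apply: ler_pM => //; first by rewrite lerDl.
    exact: fn.
  by rewrite mulrA (mulrC c) divfK ?gt_eqF// mulrC.
have Es : E s <= E t + e.
  have : `|E t - E s| <= e by apply: En; rewrite /ball_ /= distrC.
  by rewrite ler_norml; lra.
(* The main terms have the right sign: [D <= a t * mxl1 (f t) + psi t] and [E t <= 1] give [D * E t
   <= a t * mxl1 (f t) * E t + psi t], so only errors of order [e] remain. *)
have key : (D + e) * (E t + e) + (- (a t * mxl1 (f t) * E t) - psi t) + e <= eps.
  have /andP[Et0 Et1] := E01 t.
  have := ler_wpM2r Et0 dle; rewrite -/D mulrDl => H1.
  have H2 := ler_wpM2l (psi0 t) Et1.
  have H3 := ler_wpM2l (ltW e0) Et1.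
  have H4 := ler_wpM2l (ltW e0) e1.
  apply: le_trans eD; rewrite mulrDr mulrDl mulrDr.
  by rewrite mulr1 in H2 H3 H4; move: H1 H2 H3 H4; nra.
have sgw (w : R) : `|w| <= `|s - t| * (D + e) ->
    sg * w * E s <= `|s - t| * (D + e) * (E t + e).
  move=> wle; have /andP[Es0 Es1] := E01 s.
  apply: (@le_trans _ _ (`|w| * E s)).
    apply: ler_wpM2r => //; apply: le_trans (ler_norm _) _; rewrite normrM.
    by case: sg1 => ->; rewrite ?normrN1 ?normr1 mul1r.
  exact: ler_pM.
have sgst := sgw _ fl1.
have := kn _ s1; rewrite /GRing.scale/=.
move: key; set k' := (- _ - _).
move=> key; rewrite ler_norml => /andP[k1 k2]; split => st.
- have sgn := ger0_norm (_ : 0 <= s - t); rewrite sgn ?subr_ge0// in sgst k1 k2.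
  have K := ler_wpM2r (_ : 0 <= s - t) key; rewrite subr_ge0 in K.
  have {}K := K st.
  have -> : h s - h t = sg * (mxl1 (f s) - mxl1 (f t)) * E s + (k s - k t).
    by rewrite /h /k; ring.
  apply: le_trans K; move: k2 sgst.
  move: (k s - k t) (sg * _ * E s) (s - t) => x y z; nra.
- have sgst' := sgw (mxl1 (f t) - mxl1 (f s)).
  rewrite distrC in sgst'; have {}sgst' := sgst' fl1.
  have sgn : `|s - t| = t - s by rewrite distrC ger0_norm// subr_ge0.
  rewrite sgn in sgst' k1 k2.
  have K := ler_wpM2r (_ : 0 <= t - s) key; rewrite subr_ge0 in K.
  have {}K := K st.
  have -> : h t - h s = sg * (mxl1 (f t) - mxl1 (f s)) * E s - (k s - k t).
    by rewrite /h /k; ring.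
  apply: le_trans K; move: k1 sgst'.
  rewrite (_ : (s - t) * k' = - ((t - s) * k')); last by ring.
  move: (k s - k t) (sg * _ * E s) (t - s) => x y z; nra.
Qed.

End damped.

(** The damping weight stays between [expR (- alpha)] and 1, and the primitive [P] of [psi] varies
    by at most [beta]; undoing the damping costs the factor [expR alpha]. *)
Lemma gronwall_ae (R : realType) (n : nat) (I : set R) (f : R -> 'M[R]_n)
    (a psi : R -> R) (alpha beta t0 : R) :
  is_interval I -> measurable I -> abs_continuous_on (@mxl1 R n) I f -> I t0 ->
  (forall t, 0 <= a t) -> (leb R).-integrable I (EFin \o a) ->
  (\int[leb R]_(t in I) (a t)%:E <= alpha%:E)%E ->
  (forall t, 0 <= psi t) -> (leb R).-integrable I (EFin \o psi) ->
  (\int[leb R]_(t in I) (psi t)%:E <= beta%:E)%E ->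
  {ae leb R, forall t : R, I t ->
    exists2 d, is_derive t 1 f d & mxl1 d <= a t * mxl1 (f t) + psi t} ->
  forall t, I t -> mxl1 (f t) <= expR alpha * (mxl1 (f t0) + beta).
Proof.
move=> Iitv mI fAC It0 a0 ia aalpha p0 ip pbeta df t It.
have [G [Gm G01 dG]] := primitive_of_integrable mI a0 ia aalpha.
have [P [Pm P01 dP]] := primitive_of_integrable mI p0 ip pbeta.
have goalE (e : R) : expR (- alpha) <= e -> mxl1 (f t) * e <= mxl1 (f t0) + beta ->
    mxl1 (f t) <= expR alpha * (mxl1 (f t0) + beta).
  move=> ele /(le_trans (ler_wpM2l (mxl1_ge0 _) ele)).
  by rewrite expRN -ler_pdivrMl ?expR_gt0// mulrC.
have PP : `|P t - P t0| <= beta.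
  have /andP[? ?] := P01 t; have /andP[? ?] := P01 t0.
  by rewrite ler_norml; apply/andP; split; lra.
move: PP; rewrite ler_norml => /andP[P1 P2].
have [t0t|tt0] := leP t0 t.
- pose E s := expR (- G s).
  have E01 s : 0 <= E s <= 1.
    by rewrite expR_ge0 -expR0 ler_expR; have /andP[] := G01 s; lra.
  have Em u v : u <= v -> 1 * E v <= 1 * E u.
    by move=> uv; rewrite !mul1r ler_expR lerN2; exact: Gm.
  have dE : {ae leb R, forall t : R, I t -> is_derive t 1 E (- 1 * a t * E t)}.
    move: dG; apply: filterS; first exact: (ae_filter_ringOfSetsType (leb R)).
    move=> s /[apply] dGs.
    have dNG : is_derive s 1 (- G) (- a s) by exact: is_deriveN.
    by have := @is_derive1_comp _ expR (- G) _ _ _ (is_derive_expR _) dNG; rewrite mulN1r mulrC.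
  have := damped_nonincreasing Iitv fAC (or_introl erefl) E01 Em Pm p0 df dE dP It0 It t0t.
  rewrite !mul1r => H.
  apply: (goalE (E t)).
    by rewrite ler_expR lerN2; have /andP[] := G01 t.
  have := mxl1_ge0 (f t0); have /andP[] := E01 t0; move: H P1 P2; nra.
(* Subtracting [alpha] keeps the nondecreasing weight at most 1. Monotonicity is now read from [t]
   to [t0], and the sign -1 turns it into an upper bound for [mxl1 (f t)]. *)
- pose E s := expR (G s - alpha).
  have E01 s : 0 <= E s <= 1.
    by rewrite expR_ge0 -expR0 ler_expR; have /andP[] := G01 s; lra.
  have Em u v : u <= v -> -1 * E v <= -1 * E u.
    by move=> uv; rewrite !mulN1r lerN2 ler_expR lerD2r; exact: Gm.
  have dE : {ae leb R, forall t : R, I t -> is_derive t 1 E (- -1 * a t * E t)}.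
    move: dG; apply: filterS; first exact: (ae_filter_ringOfSetsType (leb R)).
    move=> s /[apply] dGs.
    have dGa : is_derive s 1 (G - cst alpha) (a s - 0) by apply: is_deriveB.
    have := @is_derive1_comp _ expR (G - cst alpha) _ _ _ (is_derive_expR _) dGa.
    by rewrite opprK mul1r subr0 mulrC.
  have := damped_nonincreasing Iitv fAC (or_intror erefl) E01 Em Pm p0 df dE dP It It0 (ltW tt0).
  rewrite !mulN1r => H.
  apply: (goalE (E t)).
    by rewrite ler_expR; have /andP[] := G01 t; lra.
  have := mxl1_ge0 (f t0); have /andP[] := E01 t0; move: H P1 P2; nra.
Qed.

(** * Linear systems: a priori bound and comparison of two solutions *)

Definition entries_integrable (R : realType) (n : nat) (I : set R)
    (B : R -> 'M[R]_n) : Prop :=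
  forall i j, (leb R).-integrable I (fun t => (B t i j)%:E).

Lemma integrable_mxl1 (R : realType) (n : nat) (I : set R) (B : R -> 'M[R]_n) :
  measurable I -> entries_integrable I B ->
  (leb R).-integrable I (EFin \o (fun t => mxl1 (B t))).
Proof.
move=> mI iB.
have mI' : @measurable _ (caratheodory_type (wlength (@idfun R))^*%mu) I.
  exact: borel_completed_measurable.
rewrite (_ : _ \o _ = fun t => (\sum_(ij : 'I_n * 'I_n) `|B t ij.1 ij.2|%:E)%E); last first.
  by apply/funext => t; rewrite /= sumEFin.
apply: integrable_sum => //.
by move=> ij _; apply: integrable_norm; exact: iB.
Qed.

Lemma integral_mxl1_le (R : realType) (n : nat) (I : set R) (N : 'M[R]_n -> R)
    (C K : R) (B : R -> 'M[R]_n) :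
  measurable I -> entries_integrable I B ->
  0 < C -> (forall u, mxl1 u <= C * N u) ->
  (\int[leb R]_(t in I) (N (B t))%:E <= K%:E)%E ->
  (\int[leb R]_(t in I) (mxl1 (B t))%:E <= (C * K)%:E)%E.
Proof.
move=> mI iB C0 CN BK.
have mI' : @measurable _ (caratheodory_type (wlength (@idfun R))^*%mu) I.
  exact: borel_completed_measurable.
have /integrableP[mB _] := integrable_mxl1 mI iB.
(* The constant moves to the l1 side, where measurability is at hand; [N (B t)] is then compared
   without using any. *)
rewrite EFinM -lee_pdivrMl//; apply: le_trans BK.
rewrite -ge0_integralZl//; last 2 first.
- by move=> t _; rewrite lee_fin mxl1_ge0.
- by rewrite lee_fin invr_ge0 ltW.
apply: ge0_le_integral_nonmeasurable => t _.
  by rewrite mule_ge0// lee_fin ?invr_ge0 ?mxl1_ge0// ltW.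
by rewrite -EFinM lee_fin ler_pdivrMl.
Qed.

Lemma abs_continuous_on_le (R : realType) (n : nat) (N1 N2 : 'M[R]_n -> R)
    (C : R) (I : set R) (X : R -> 'M[R]_n) :
  0 < C -> (forall u, N2 u <= C * N1 u) ->
  abs_continuous_on N1 I X -> abs_continuous_on N2 I X.
Proof.
move=> C0 NC acX eps eps0.
have [delta delta0 H] := acX _ (divr_gt0 eps0 C0); exists delta => // k a b ab tr lt.
apply: (@le_lt_trans _ _ (C * \sum_(i < k) N1 (X (b i) - X (a i)))).
  by rewrite mulr_sumr; apply: ler_sum => i _; exact: NC.
by rewrite mulrC -ltr_pdivlMr//; exact: H.
Qed.

Lemma abs_continuous_onB (R : realType) (n : nat) (I : set R) (X Y : R -> 'M[R]_n) :
  abs_continuous_on (@mxl1 R n) I X -> abs_continuous_on (@mxl1 R n) I Y ->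
  abs_continuous_on (@mxl1 R n) I (fun t => X t - Y t).
Proof.
move=> acX acY eps eps0; have eps2 : 0 < eps / 2 by rewrite divr_gt0.
have [d1 d10 H1] := acX _ eps2; have [d2 d20 H2] := acY _ eps2.
exists (Num.min d1 d2); first by rewrite lt_min d10.
move=> k a b ab tr; rewrite lt_min => /andP[lt1 lt2].
apply: (@le_lt_trans _ _ (\sum_(i < k) mxl1 (X (b i) - X (a i)) +
    \sum_(i < k) mxl1 (Y (b i) - Y (a i)))); last first.
  by rewrite [ltRHS]splitr ltrD//; [exact: H1|exact: H2].
rewrite -big_split/=; apply: ler_sum => i _.
rewrite (_ : _ - _ = (X (b i) - X (a i)) - (Y (b i) - Y (a i))); last first.
  by rewrite !opprD !opprK addrACA.
apply: le_trans (mxl1D _ _) _.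
by rewrite lerD2l -scaleN1r mxl1Z normrN1 mul1r.
Qed.

Section linear_system.
Variables (R : realType) (n : nat) (I : set R) (t0 : R).
Hypotheses (Iitv : is_interval I) (mI : measurable I) (It0 : I t0).

Definition linear_solution (A Phi X : R -> 'M[R]_n) : Prop :=
  abs_continuous_on (@mxl1 R n) I X /\
  {ae leb R, forall t : R, I t -> is_derive t 1 X (A t *m X t + Phi t)}.

Lemma linear_solution_bounded A Phi X alpha beta :
  entries_integrable I A -> entries_integrable I Phi ->
  (\int[leb R]_(t in I) (mxl1 (A t))%:E <= alpha%:E)%E ->
  (\int[leb R]_(t in I) (mxl1 (Phi t))%:E <= beta%:E)%E ->
  linear_solution A Phi X ->
  forall t, I t -> mxl1 (X t) <= expR alpha * (mxl1 (X t0) + beta).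
Proof.
move=> iA iPhi Aa Pb [acX dX].
apply: (gronwall_ae Iitv mI acX It0 _ _ Aa _ _ Pb).
- by move=> t; exact: mxl1_ge0.
- exact: integrable_mxl1.
- by move=> t; exact: mxl1_ge0.
- exact: integrable_mxl1.
- move: dX; apply: filterS; first exact: (ae_filter_ringOfSetsType (leb R)).
  move=> t /[apply] dXt; exists (A t *m X t + Phi t) => //.
  by apply: le_trans (mxl1D _ _) _; rewrite lerD2r; exact: mxl1M.
Qed.

Section difference.
Variables A1 A2 Phi1 Phi2 X1 X2 : R -> 'M[R]_n.
Variables alpha kappa eta : R.
Hypotheses (iA1 : entries_integrable I A1) (iA2 : entries_integrable I A2).
Hypotheses (iPhi1 : entries_integrable I Phi1) (iPhi2 : entries_integrable I Phi2).
Hypotheses (sol1 : linear_solution A1 Phi1 X1) (sol2 : linear_solution A2 Phi2 X2).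
Hypothesis A1alpha : (\int[leb R]_(t in I) (mxl1 (A1 t))%:E <= alpha%:E)%E.
Hypothesis Aeta : (\int[leb R]_(t in I) (mxl1 (A1 t - A2 t))%:E <= eta%:E)%E.
Hypothesis Phieta : (\int[leb R]_(t in I) (mxl1 (Phi1 t - Phi2 t))%:E <= eta%:E)%E.
Hypothesis X2kappa : forall t, I t -> mxl1 (X2 t) <= kappa.

Let kappa0 : 0 <= kappa.
Proof. exact: le_trans (mxl1_ge0 _) (X2kappa It0). Qed.

(** Dominates the inhomogeneity in the equation for [X1 - X2], with [X2] already replaced by its
    bound [kappa]. *)
Let psi t := kappa * mxl1 (A1 t - A2 t) + mxl1 (Phi1 t - Phi2 t).

Let psi0 t : 0 <= psi t.
Proof. by rewrite addr_ge0 ?mulr_ge0 ?mxl1_ge0. Qed.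

Let mI' : @measurable _ (caratheodory_type (wlength (@idfun R))^*%mu) I.
Proof. exact: borel_completed_measurable. Qed.

Let iB (B1 B2 : R -> 'M[R]_n) : entries_integrable I B1 -> entries_integrable I B2 ->
  entries_integrable I (fun t => B1 t - B2 t).
Proof.
move=> i1 i2 i j; rewrite (_ : (fun t => _) = (fun t => (B1 t i j)%:E - (B2 t i j)%:E)%E).
  exact: integrableB.
by apply/funext => t; rewrite !mxE EFinB.
Qed.

Let idA : (leb R).-integrable I (EFin \o (fun t => mxl1 (A1 t - A2 t))).
Proof. by apply: integrable_mxl1 => //; exact: iB. Qed.

Let idPhi : (leb R).-integrable I (EFin \o (fun t => mxl1 (Phi1 t - Phi2 t))).
Proof. by apply: integrable_mxl1 => //; exact: iB. Qed.

Let ipsi : (leb R).-integrable I (EFin \o psi).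
Proof.
rewrite (_ : EFin \o psi = (fun t => kappa%:E * (mxl1 (A1 t - A2 t))%:E +
    (mxl1 (Phi1 t - Phi2 t))%:E)%E); last first.
  by apply/funext => t; rewrite /= EFinD EFinM.
by apply: integrableD => //; exact: integrableZl.
Qed.

Let psi_le : (\int[leb R]_(t in I) (psi t)%:E <= (kappa * eta + eta)%:E)%E.
Proof.
rewrite (_ : (fun t => (psi t)%:E) = (fun t => kappa%:E * (mxl1 (A1 t - A2 t))%:E +
    (mxl1 (Phi1 t - Phi2 t))%:E)%E); last first.
  by apply/funext => t; rewrite /= EFinD EFinM.
rewrite integralD//; last exact: integrableZl.
by rewrite integralZl// EFinD EFinM leeD// lee_wpmul2l// lee_fin.
Qed.

Let dX12 t : A1 t *m X1 t + Phi1 t - (A2 t *m X2 t + Phi2 t) =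
  A1 t *m (X1 t - X2 t) + ((A1 t - A2 t) *m X2 t + (Phi1 t - Phi2 t)).
Proof.
rewrite mulmxBr mulmxBl.
move: (A1 t *m X1 t) (A2 t *m X2 t) (A1 t *m X2 t) => a b c.
by rewrite [RHS]addrA (addrA (a - c)) subrK opprD addrACA.
Qed.

Let dX12_le t : I t ->
  mxl1 (A1 t *m X1 t + Phi1 t - (A2 t *m X2 t + Phi2 t)) <=
  mxl1 (A1 t) * mxl1 (X1 t - X2 t) + psi t.
Proof.
move=> It; rewrite dX12; apply: le_trans (mxl1D _ _) _; apply: lerD.
  exact: mxl1M.
apply: le_trans (mxl1D _ _) _; rewrite lerD2r.
apply: le_trans (mxl1M _ _) _; rewrite mulrC; apply: ler_wpM2r; first exact: mxl1_ge0.
exact: X2kappa.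
Qed.

Lemma linear_solution_dist t : I t ->
  mxl1 (X1 t - X2 t) <= expR alpha * (mxl1 (X1 t0 - X2 t0) + (kappa * eta + eta)).
Proof.
have [[ac1 d1] [ac2 d2]] := (sol1, sol2).
apply: (gronwall_ae Iitv mI (abs_continuous_onB ac1 ac2) It0 _ _ A1alpha psi0 ipsi psi_le).
- by move=> s; exact: mxl1_ge0.
- exact: integrable_mxl1.
- move: d1 d2; apply: filterS2; first exact: (ae_filter_ringOfSetsType (leb R)).
  move=> s d1 d2 Is.
  exists (A1 s *m X1 s + Phi1 s - (A2 s *m X2 s + Phi2 s)); last exact: dX12_le.
  by apply: is_deriveB; [exact: d1|exact: d2].
Qed.

(** Almost everywhere the derivatives are the right-hand sides of the equations, so the integrand is
    dominated by the measurable function [C * (D * mxl1 (A1 t) + psi t)]. *)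
Lemma linear_solution_derivative_dist (N : 'M[R]_n -> R) (C D : R) :
  (forall u, 0 <= N u) -> 0 <= C -> 0 <= D -> (forall u, N u <= C * mxl1 u) ->
  (forall t, I t -> mxl1 (X1 t - X2 t) <= D) ->
  (\int[leb R]_(t in I) (N (derive1 X1 t - derive1 X2 t))%:E <=
   (C * (D * alpha + (kappa * eta + eta)))%:E)%E.
Proof.
move=> N0 C0 D0 NC XD.
have [[ac1 d1] [ac2 d2]] := (sol1, sol2).
have iA : (leb R).-integrable I (EFin \o (fun t => mxl1 (A1 t))).
  exact: integrable_mxl1.
have ig : (leb R).-integrable I (fun t => D%:E * (mxl1 (A1 t))%:E + (psi t)%:E)%E.
  by apply: integrableD => //; exact: integrableZl.
apply: (@le_trans _ _ (\int[leb R]_(t in I)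
    (C%:E * (D%:E * (mxl1 (A1 t))%:E + (psi t)%:E)))%E); last first.
  rewrite integralZl// EFinM lee_wpmul2l ?lee_fin// integralD//; last exact: integrableZl.
  by rewrite EFinD EFinM leeD// integralZl// lee_wpmul2l ?lee_fin.
apply: ge0_le_integral_dominating => //.
- by move=> t _; rewrite lee_fin.
- move=> t _; rewrite -EFinM lee_fin mulr_ge0// addr_ge0//.
  by rewrite mulr_ge0// mxl1_ge0.
- by have /integrableP[] : (leb R).-integrable I (fun t =>
    C%:E * (D%:E * (mxl1 (A1 t))%:E + (psi t)%:E))%E by exact: integrableZl.
- move: d1 d2; apply: filterS2; first exact: (ae_filter_ringOfSetsType (leb R)).
  move=> t d1 d2 It.
  have [[_ E1] [_ E2]] := (d1 It, d2 It).
  rewrite !derive1E E1 E2 -EFinM lee_fin.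
  apply: le_trans (NC _) _; apply: ler_wpM2l => //.
  apply: le_trans (dX12_le It) _; rewrite lerD2r mulrC.
  by apply: ler_wpM2r; [exact: mxl1_ge0|exact: XD].
Qed.

End difference.
End linear_system.

(** * Uniform continuity in the parameter *)

(** Common core for [Y] and [Z]. The data are bounded uniformly in [mu], so the Gronwall constants
    do not depend on [mu] and both distances are linear in the modulus [eta] of the data. *)
Lemma solution_uniformly_continuous (R : realType) (m n : nat)
    (nrmV : 'rV[R]_m -> R) (nrmM : 'M[R]_n -> R) (nrmM_norm : is_norm nrmM)
    (I : set R) (I_open : open I) (I_itv : is_interval I) (t0 : R) (It0 : I t0)
    (M : set 'rV[R]_m) (A Phi : R -> 'rV[R]_m -> 'M[R]_n)
    (A_summable : summable_on I M A) (Phi_summable : summable_on I M Phi)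
    (X0 : 'rV[R]_m -> 'M[R]_n)
    (nhat_bounded : exists K : R, forall mu, M mu ->
       (norm_integral nrmM I A mu <= K%:E)%E)
    (phi_bounded : exists K : R, forall mu, M mu ->
       (norm_integral nrmM I Phi mu <= K%:E)%E)
    (eta_bounded : exists K : R, forall mu, M mu -> nrmM (X0 mu) <= K)
    (X0_ucont : unif_continuous_on nrmV nrmM M X0)
    (A_iucont : integrally_unif_continuous_on nrmV nrmM I M A)
    (Phi_iucont : integrally_unif_continuous_on nrmV nrmM I M Phi)
    (X : R -> 'rV[R]_m -> 'M[R]_n)
    (X_sol : is_solution nrmM I M t0
       (fun t mu X => A t mu *m X + Phi t mu) X0 X) :
  forall eps : R, 0 < eps -> exists2 delta : R, 0 < delta &
    forall mu1 mu2, M mu1 -> M mu2 -> nrmV (mu1 - mu2) < delta ->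
      (forall t, I t -> nrmM (X t mu1 - X t mu2) < eps) /\
      (rho nrmM I t0 (X^~ mu1) (X^~ mu2) < eps%:E)%E.
Proof.
have [C C0 CN] := mxl1_le_norm nrmM_norm.
have [c c0 Nc] := norm_le_mxl1 nrmM_norm.
have N0 u : 0 <= nrmM u.
  by have := le_trans (mxl1_ge0 u) (CN u); rewrite pmulr_rge0.
have mI : measurable I by exact: open_measurable.
have bnd (B : R -> 'rV[R]_m -> 'M[R]_n) (K : R) : summable_on I M B ->
    (forall mu, M mu -> (norm_integral nrmM I B mu <= K%:E)%E) ->
    forall mu, M mu -> (\int[leb R]_(t in I) (mxl1 (B t mu))%:E <= (C * `|K|)%:E)%E.
  move=> sB BK mu Mmu; apply: (integral_mxl1_le mI (sB _ Mmu) C0 CN).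
  by apply: le_trans (BK _ Mmu) _; rewrite lee_fin ler_norm.
have dist (B : R -> 'rV[R]_m -> 'M[R]_n) (e : R) mu1 mu2 : summable_on I M B ->
    M mu1 -> M mu2 ->
    (\int[leb R]_(t in I) (nrmM (B t mu1 - B t mu2))%:E < (e / C)%:E)%E ->
    (\int[leb R]_(t in I) (mxl1 (B t mu1 - B t mu2))%:E <= e%:E)%E.
  move=> sB M1 M2 /ltW lt; have -> : e = C * (e / C) by rewrite mulrC divfK ?gt_eqF.
  apply: (integral_mxl1_le mI _ C0 CN lt) => i j.
  rewrite (_ : (fun t => _) = (fun t => (B t mu1 i j)%:E - (B t mu2 i j)%:E)%E).
    by apply: integrableB; [exact: borel_completed_measurable|exact: sB|exact: sB].
  by apply/funext => t; rewrite !mxE EFinB.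
case: nhat_bounded => KA /(bnd _ _ A_summable) Aa.
case: phi_bounded => KP /(bnd _ _ Phi_summable) Pb.
case: eta_bounded => K0 X0K.
set alpha := C * `|KA| in Aa; set beta := C * `|KP| in Pb.
have alpha0 : 0 <= alpha by rewrite mulr_ge0// ltW.
have beta0 : 0 <= beta by rewrite mulr_ge0// ltW.
(* The a priori bound, valid for all [mu] and [t] at once. *)
pose kappa := expR alpha * (C * `|K0| + beta).
have kappa0 : 0 <= kappa by rewrite mulr_ge0 ?expR_ge0// addr_ge0// mulr_ge0// ltW.
have sol mu : M mu -> linear_solution I (A^~ mu) (Phi^~ mu) (X^~ mu).
  move=> Mmu; have [acX dX _] := X_sol _ Mmu; split => //.
  exact: (abs_continuous_on_le C0 CN acX).
have init mu : M mu -> X t0 mu = X0 mu by move=> Mmu; have [] := X_sol _ Mmu.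
have Xk mu : M mu -> forall t, I t -> mxl1 (X t mu) <= kappa.
  move=> Mmu t It.
  apply: le_trans (linear_solution_bounded I_itv mI It0 (A_summable _ Mmu)
    (Phi_summable _ Mmu) (Aa _ Mmu) (Pb _ Mmu) (sol _ Mmu) It) _.
  apply: ler_wpM2l; first exact: expR_ge0.
  rewrite lerD2r init//; apply: le_trans (CN _) _; apply: ler_wpM2l; first exact: ltW.
  by apply: le_trans (X0K _ Mmu) _; exact: ler_norm.
move=> eps eps0.
(* [b * eta] bounds the l1 distance of two solutions: one [eta] comes from the initial values,
   [kappa * eta] from [A] and one [eta] from [Phi]. *)
pose b := expR alpha * (kappa + 2).
have b0 : 0 <= b by rewrite mulr_ge0 ?expR_ge0// addr_ge0.
(* [q * eta] bounds [rho]: [C^-1] accounts for the initial distance [eta / C], the other term for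
   the integral of the derivatives. *)
pose q := C^-1 + c * (b * alpha + (kappa + 1)).
have q0 : 0 <= q.
  apply: addr_ge0; first by rewrite invr_ge0 ltW.
  by apply: mulr_ge0 => //; apply: addr_ge0; [exact: mulr_ge0|exact: addr_ge0].
have cb0 : 0 <= c * b by rewrite mulr_ge0.
(* Makes both [q * eta] and [c * b * eta] smaller than [eps]; the added 1 gives strictness and a
   nonzero denominator. *)
pose eta := eps / (q + c * b + 1).
have Q0 : 0 < q + c * b + 1 by rewrite ltr_wpDl// addr_ge0.
have eta0 : 0 < eta by rewrite divr_gt0.
have etaE : eta * (q + c * b + 1) = eps by rewrite divfK ?gt_eqF.
(* Closeness [eta / C] in the given norm becomes closeness [eta] in the l1 norm. *)
have etaC : 0 < eta / C by rewrite divr_gt0.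
have [d1 d10 H1] := X0_ucont _ etaC.
have [d2 d20 H2] := A_iucont _ etaC.
have [d3 d30 H3] := Phi_iucont _ etaC.
exists (Num.min d1 (Num.min d2 d3)); first by rewrite !lt_min d10 d20.
move=> mu1 mu2 M1 M2; rewrite !lt_min => /and3P[l1 l2 l3].
have XD : nrmM (X t0 mu1 - X t0 mu2) < eta / C by rewrite !init//; exact: H1.
have Ad := dist _ _ _ _ A_summable M1 M2 (H2 _ _ M1 M2 l2).
have Pd := dist _ _ _ _ Phi_summable M1 M2 (H3 _ _ M1 M2 l3).
have Xd t : I t -> mxl1 (X t mu1 - X t mu2) <= b * eta.
  move=> It.
  apply: le_trans (linear_solution_dist I_itv mI It0 (A_summable _ M1)
    (A_summable _ M2) (Phi_summable _ M1) (Phi_summable _ M2) (sol _ M1) (sol _ M2)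
    (Aa _ M1) Ad Pd (Xk _ M2) It) _.
  rewrite /b -mulrA; apply: ler_wpM2l; first exact: expR_ge0.
  rewrite (_ : (kappa + 2) * eta = eta + (kappa * eta + eta)); last by ring.
  rewrite lerD2r; apply: le_trans (CN _) _.
  by rewrite mulrC -ler_pdivlMr// ltW.
split.
- move=> t It; apply: le_lt_trans (Nc _) _.
  apply: le_lt_trans (ler_wpM2l c0 (Xd t It)) _.
  rewrite -etaE mulrA; have := mulr_ge0 (ltW eta0) q0; move: eta0; nra.
- rewrite /rho.
  apply: (@le_lt_trans _ _ ((eta / C)%:E +
      (c * (b * eta * alpha + (kappa * eta + eta)))%:E)%E).
    apply: leeD; first by rewrite lee_fin ltW.
    apply: (linear_solution_derivative_dist mI It0 (A_summable _ M1)
      (A_summable _ M2) (Phi_summable _ M1) (Phi_summable _ M2) (sol _ M1) (sol _ M2)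
      (Aa _ M1) Ad Pd (Xk _ M2)) => //.
    by rewrite mulr_ge0// ltW.
  rewrite -EFinD lte_fin (_ : eta / C + _ = eta * q); last by rewrite /q; ring.
  rewrite -etaE ltr_pM2l// -addrA ltrDl ltr_wpDl//.
Qed.

Theorem theorem3p1 (R : realType) (m n : nat)
    (nrmV : 'rV[R]_m -> R) (nrmM : 'M[R]_n -> R)
    (nrmV_norm : is_norm nrmV) (nrmM_norm : is_norm nrmM)
    (I : set R) (I_open : open I) (I_itv : is_interval I)
    (t0 : R) (It0 : I t0)
    (M : set 'rV[R]_m) (M_open : open M) (M_conn : connected M)
    (A Phi : R -> 'rV[R]_m -> 'M[R]_n)
    (A_summable : summable_on I M A) (Phi_summable : summable_on I M Phi)
    (X0 : 'rV[R]_m -> 'M[R]_n)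
    (X0_cont : {within M, continuous X0})
    (X0_bounded : [bounded X0 mu | mu in M])
    (nhat_bounded : exists K : R, forall mu, M mu ->
       (norm_integral nrmM I A mu <= K%:E)%E)
    (phi_bounded : exists K : R, forall mu, M mu ->
       (norm_integral nrmM I Phi mu <= K%:E)%E)
    (eta_bounded : exists K : R, forall mu, M mu -> nrmM (X0 mu) <= K)
    (X0_ucont : unif_continuous_on nrmV nrmM M X0)
    (A_iucont : integrally_unif_continuous_on nrmV nrmM I M A)
    (Phi_iucont : integrally_unif_continuous_on nrmV nrmM I M Phi)
    (Y Z : R -> 'rV[R]_m -> 'M[R]_n)
    (Y_sol : is_solution nrmM I M t0
       (fun t mu X => A t mu *m X + Phi t mu) X0 Y)
    (Z_sol : is_solution nrmM I M t0 (fun t mu X => A t mu *m X) X0 Z) :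
  forall eps : R, 0 < eps -> exists2 delta : R, 0 < delta &
    forall mu1 mu2, M mu1 -> M mu2 -> nrmV (mu1 - mu2) < delta ->
      [/\ forall t, I t -> nrmM (Y t mu1 - Y t mu2) < eps,
          forall t, I t -> nrmM (Z t mu1 - Z t mu2) < eps,
          (rho nrmM I t0 (Y^~ mu1) (Y^~ mu2) < eps%:E)%E
        & (rho nrmM I t0 (Z^~ mu1) (Z^~ mu2) < eps%:E)%E].
Proof.
move=> eps eps0.
have [dY dY0 HY] := solution_uniformly_continuous nrmM_norm I_open I_itv It0 A_summable
  Phi_summable nhat_bounded phi_bounded eta_bounded X0_ucont A_iucont Phi_iucont
  Y_sol eps0.
have N0 : nrmM 0 = 0.
  by case: nrmM_norm => _ NZ _; rewrite -(scale0r 0) NZ normr0 mul0r.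
(* [Z] solves the inhomogeneous problem with zero inhomogeneity, so the same lemma covers it. *)
pose O := fun (_ : R) (_ : 'rV[R]_m) => 0 : 'M[R]_n.
have O_summable : summable_on I M O.
  move=> mu _ i j; rewrite (_ : (fun t => _) = cst 0%E); first exact: integrable0.
  by apply/funext => t; rewrite mxE.
have O_bounded : exists K : R, forall mu, M mu ->
    (norm_integral nrmM I O mu <= K%:E)%E.
  by exists 0 => mu _; rewrite /norm_integral integral0_eq// => t _; rewrite /O N0.
have O_iucont : integrally_unif_continuous_on nrmV nrmM I M O.
  move=> e e0; exists 1 => // mu1 mu2 _ _ _.
  by rewrite integral0_eq ?lte_fin// => t _; rewrite /O subrr N0.
have Z_sol' : is_solution nrmM I M t0 (fun t mu X => A t mu *m X + O t mu) X0 Z.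
  rewrite (_ : (fun t mu X => _) = (fun t mu X => A t mu *m X))//.
  by apply/funext => t; apply/funext => mu; apply/funext => X; rewrite addr0.
have [dZ dZ0 HZ] := solution_uniformly_continuous nrmM_norm I_open I_itv It0 A_summable
  O_summable nhat_bounded O_bounded eta_bounded X0_ucont A_iucont O_iucont
  Z_sol' eps0.
exists (Num.min dY dZ); first by rewrite lt_min dY0.
move=> mu1 mu2 M1 M2; rewrite lt_min => /andP[ltY ltZ].
have [Y1 Y2] := HY _ _ M1 M2 ltY; have [Z1 Z2] := HZ _ _ M1 M2 ltZ.
by split.
Qed.
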